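(* The face $C=\mathrm{Conv}\{\mathtt{PR},\mathtt P_0,\mathtt P_1\}$ of the non-signalling polytope is a quantum void: $$\mathcal Q\cap C=\mathrm{Conv}\{\mathtt P_0,\mathtt P_1\}.$$
   Context: Boxes are functions $\mathtt P:\{0,1\}^4\to\mathbb R$, $\mathtt P(a,b|x,y)$. $\mathtt{PR}(a,b|x,y)=\frac12\mathbf 1_{a\oplus b=xy}$, $\mathtt P_0(a,b|x,y)=\mathbf 1_{a=b=0}$, $\mathtt P_1(a,b|x,y)=\mathbf 1_{a=b=1}$. The quantum (tensor) set $\mathcal Q$ is the set of boxes of the form $\mathtt P(a,b|x,y)=\langle\Psi|\,(E^x_a\otimes F^y_b)\,|\Psi\rangle$, where for each $x\in\{0,1\}$ (resp. $y\in\{0,1\}$) $\{E^x_a\}_{a\in\{0,1\}}$ (resp. $\{F^y_b\}_{b\in\{0,1\}}$) is a POVM on a Hilbert space $\mathcal H_A$ (resp. $\mathcal H_B$), and $|\Psi\rangle\in\mathcal H_A\otimes\mathcal H_B$ is a unit vector. A quantum void is a subset of the boundary of the non-signalling polytope in which every quantum box is local; here this is expressed by the displayed equality. *)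

(* Defs.v *)
From HB Require Import structures.
From mathcomp Require Import all_boot all_order all_algebra.
From mathcomp Require Import complex.
From mathcomp Require Import all_classical all_reals all_analysis.

Set Implicit Arguments.
Unset Strict Implicit.
Unset Printing Implicit Defensive.

Import Order.TTheory GRing.Theory Num.Theory.
Import numFieldNormedType.Exports.

Local Open Scope classical_set_scope.
Local Open Scope ring_scope.
Local Open Scope complex_scope.

(* Outcomes and inputs are booleans, with 0 := false and 1 := true.           *)
(* P a b x y stands for P(a,b|x,y); R^o is R as a module over itself, so that *)
(* boxes form an lmodType R.                                                  *)
Definition box (R : realType) := bool -> bool -> bool -> bool -> R^o.

Definition PR (R : realType) : box R :=
  fun a b x y => 2^-1 * ((a (+) b) == (x && y))%:R.

Definition P0 (R : realType) : box R :=
  fun a b _ _ => ((a == false) && (b == false))%:R.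

Definition P1 (R : realType) : box R :=
  fun a b _ _ => ((a == true) && (b == true))%:R.

Arguments PR : clear implicits.
Arguments P0 : clear implicits.
Arguments P1 : clear implicits.

Definition Conv (R : realType) (V : lmodType R) (A : set V) : set V :=
  [set p | exists (n : nat) (w : 'I_n -> R) (q : 'I_n -> V),
     [/\ forall i, 0 <= w i,
         \sum_i w i = 1,
         forall i, A (q i) &
         p = \sum_i w i *: q i]].

(* Complex Hilbert spaces of arbitrary dimension. The form is linear in its   *)
(* first argument and conjugate-linear in the second one: the bracket         *)
(* <u|v> of physics is inner v u.                                             *)
Record hilbert (R : realType) := Hilbert {
  hilbert_sort :> completeNormedModType R[i];
  inner : {dot hilbert_sort for (@Num.conj R[i])};
  innerE : forall u : hilbert_sort, inner u u = `|u| ^+ 2 }.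

(* The Hilbert tensor product of HA and HB, unique up to a unitary: a Hilbert *)
(* space with a bilinear map (u, v) |-> u (x) v that multiplies inner         *)
(* products and whose values span a dense subspace.                           *)
Record hilbert_tensor (R : realType) (HA HB : hilbert R) := HilbertTensor {
  tensor_sort :> hilbert R;
  tensor : {bilinear HA -> HB -> tensor_sort};
  inner_tensor : forall (u u' : HA) (v v' : HB),
    inner tensor_sort (tensor u v) (tensor u' v')
      = inner HA u u' * inner HB v v';
  tensor_dense : dense [set w : tensor_sort |
    exists (n : nat) (u : 'I_n -> HA) (v : 'I_n -> HB),
      w = \sum_i tensor (u i) (v i)] }.

(* T is the bounded operator E (x) F: for bounded E and F it exists and is    *)
(* determined by its values on the simple tensors.                            *)
Definition is_tensor_op (R : realType) (HA HB : hilbert R)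
    (H : hilbert_tensor HA HB)
    (E : {linear HA -> HA}) (F : {linear HB -> HB}) (T : {linear H -> H}) :=
  continuous T /\ forall u v, T (tensor H u v) = tensor H (E u) (F v).

(* 0 <= z in R[i] means that z is real and nonnegative.                       *)
Definition is_povm (R : realType) (H : hilbert R)
    (E : bool -> {linear H -> H}) :=
  [/\ forall a, continuous (E a),
      forall a u, 0 <= inner H (E a u) u &
      forall u, \sum_a E a u = u].

Definition quantum_set (R : realType) : set (box R) :=
  [set P | exists (HA HB : hilbert R) (H : hilbert_tensor HA HB)
      (E : bool -> bool -> {linear HA -> HA})
      (F : bool -> bool -> {linear HB -> HB})
      (EF : bool -> bool -> bool -> bool -> {linear H -> H})
      (Psi : H),
    [/\ forall x, is_povm (E x),
        forall y, is_povm (F y),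
        forall a b x y, is_tensor_op (E x a) (F y b) (EF a b x y),
        `|Psi| = 1 &
        forall a b x y, (P a b x y)%:C = inner H (EF a b x y Psi) Psi]].

Arguments quantum_set : clear implicits.

(* Main.v *)
From HB Require Import structures.
Require Import Defs.
From mathcomp Require Import all_boot all_order all_algebra.
From mathcomp Require Import complex ring.
From mathcomp Require Import all_classical all_reals all_analysis.

(**
Write P = p PR + q P_0 + r P_1 in C. Whenever (x,y) <> (1,1), P gives
probability 0 to the outcomes a <> b; as E_a^x (x) F_b^y is positive
semidefinite, it then annihilates Psi. Summing over outcomes, 1 (x) F_0^1,
E_0^0 (x) 1 and 1 (x) F_0^0 agree on Psi, whence
  (E_1^1 (x) F_0^1) Psi = (E_1^1 (x) 1) (1 (x) F_0^1) Psi
    = (E_1^1 (x) 1) (1 (x) F_0^0) Psi = (E_1^1 (x) F_0^0) Psi = 0,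
so that p / 2 = P(1,0|1,1) = 0. Positivity of E (x) F is the Schur product
theorem on finite sums of simple tensors, extended by density.

Conversely q P_0 + r P_1 is obtained by measuring the state
sqrt q |00> + sqrt r |11> of C^2 (x) C^2 in the computational basis.
*)

Set Implicit Arguments.
Unset Strict Implicit.
Unset Printing Implicit Defensive.

Import Order.TTheory GRing.Theory Num.Theory.
Import numFieldNormedType.Exports.

Local Open Scope classical_set_scope.
Local Open Scope ring_scope.

(** * Quadratic forms, Schur products and density *)

(** A nonzero linear term would make the quadratic negative near 0. It is used in [psd_null] to show
    that a null vector of a positive form lies in the kernel. *)
Lemma ge0_quad_lin0 (C : numClosedFieldType) (a d : C) :
  (forall s, s \is Num.real -> 0 <= s * a + s ^+ 2 * d) -> a = 0.
Proof.
move=> h.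
have h1 := h 1 (rpred1 _); have h2 := h (-1) (rpredN1 _).
have rd : d \is Num.real.
  have -> : d = 2^-1 * ((1 * a + 1 ^+ 2 * d) + (-1 * a + (- 1) ^+ 2 * d)).
    by field.
  by rewrite realM ?realV ?realn// ger0_real// addr_ge0.
have ra : a \is Num.real.
  have -> : a = (1 * a + 1 ^+ 2 * d) - d by ring.
  by rewrite realB// ger0_real.
have a2 : 0 <= - a ^+ 2.
  have [d0|d0] := eqVneq d 0.
    have := h (- a); rewrite realN d0 mulr0 addr0 => /(_ ra).
    by rewrite mulNr expr2.
  have dp : 0 < d.
    have := addr_ge0 h1 h2.
    rewrite (_ : _ + _ = 2 * d); last by ring.
    by rewrite pmulr_rge0// le0r (negPf d0).
  (* The minimiser of the parabola, where its value is [- a ^+ 2 / (4 * d)]. *)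
  have := h (- a / (2 * d)).
  rewrite realM ?realN ?realV ?realM ?realn// => /(_ isT).
  rewrite (_ : _ + _ = - a ^+ 2 / (4 * d)); last by field.
  by rewrite pmulr_lge0// invr_gt0 mulr_gt0.
apply/eqP; rewrite -sqrf_eq0 eq_le -oppr_ge0 a2.
by rewrite real_exprn_even_ge0.
Qed.

(* By the spectral theorem A is a sum of rank-one matrices d_k p_k p_k^* with
   d_k >= 0, so the sum is a nonnegative combination of values of the quadratic
   form of B. *)
Lemma schur_product_ge0 (C : numClosedFieldType) n (A B : 'I_n -> 'I_n -> C) :
  (forall i j, A j i = (A i j)^*) ->
  (forall c : 'I_n -> C, 0 <= \sum_i \sum_j c i * (c j)^* * A i j) ->
  (forall c : 'I_n -> C, 0 <= \sum_i \sum_j c i * (c j)^* * B i j) ->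
  0 <= \sum_i \sum_j A i j * B i j.
Proof.
move=> Aherm Apos Bpos.
pose M := \matrix_(i, j) A i j.
have Mn : M \is hermsymmx.
  apply/is_hermitianmxP; rewrite expr0 scale1r.
  by apply/matrixP => i j; rewrite !mxE Aherm.
set P := spectralmx M; set d := spectral_diag M.
have /orthomx_spectralP ME := hermitian_normalmx Mn.
rewrite -/P -/d in ME.
have AE i j : A i j = \sum_k (P k i)^* * d 0 k * P k j.
  have /matrixP /(_ i j) := ME.
  rewrite invmx_unitary ?spectral_unitarymx// !mxE => ->.
  by apply: eq_bigr => k _; rewrite mul_mx_diag !mxE.
(* The eigenvalue [d 0 k] is the form of [A] evaluated at row [k] of [P]. *)
have dge0 k : 0 <= d 0 k.
  have := Apos (P k).
  have := congr1 (fun X => P *m X *m invmx P) ME.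
  rewrite !mulmxA mulmxV ?mul1mx; last exact: spectral_unit.
  rewrite mulmxK ?spectral_unit// invmx_unitary ?spectral_unitarymx//.
  move=> /matrixP /(_ k k).
  rewrite [RHS]mxE eqxx mulr1n => <-.
  rewrite mxE exchange_big /=; congr (0 <= _).
  apply: eq_bigr => j _; rewrite !mxE mulr_suml.
  by apply: eq_bigr => i _; rewrite !mxE mulrAC.
under eq_bigr do under eq_bigr do rewrite AE mulr_suml.
under eq_bigr do rewrite exchange_big /=.
rewrite exchange_big /=; apply: sumr_ge0 => k _.
(* The row is conjugated to match the factor [(P k i)^* * P k j] in [AE]. *)
have := mulr_ge0 (dge0 k) (Bpos (fun i => (P k i)^*)).
congr (0 <= _); rewrite mulr_sumr; apply: eq_bigr => i _.
by rewrite mulr_sumr; apply: eq_bigr => j _; rewrite conjCK; ring.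
Qed.

(** The set where [f - g] is nonzero is open, because points are closed in the norm topology; if
    nonempty, it would meet [A]. *)
Lemma eq_continuous_dense (T : topologicalType) (K : numFieldType)
    (V : pseudoMetricNormedZmodType K) (f g : T -> V) (A : set T) :
  dense A -> continuous f -> continuous g -> {in A, f =1 g} -> f =1 g.
Proof.
move=> dA cf cg fg x; apply/eqP; apply: contrapT => /negP fgx.
have cfg : continuous (fun x => f x - g x).
  by move=> y; apply: cvgB; [exact: cf|exact: cg].
have [||y [] /= ] := dA [set y | f y - g y != 0].
- by exists x; rewrite /= subr_eq0.
- apply: (open_comp (D := [set v : V | v != 0])) => [y _|]; first exact: cfg.
  rewrite (_ : [set _ | _] = ~` [set 0]); last first.
    by apply/seteqP; split => v /eqP.
  rewrite openC; apply: accessible_closed_set1.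
  exact/hausdorff_accessible/norm_hausdorff.
- by move=> nz Ay; move: nz; rewrite fg ?inE// subrr eqxx.
Qed.

(** * Inner products and positive operators *)

Section InnerProduct.
Variables (R : realType) (H : hilbert R).
Local Notation "''[' u , v ]" := (inner H u v) : ring_scope.

Lemma innerDl u v w : '[u + v, w] = '[u, w] + '[v, w].
Proof. exact: linearDl. Qed.

Lemma innerDr u v w : '[w, u + v] = '[w, u] + '[w, v].
Proof. exact: linearDr. Qed.

Lemma innerZl a u v : '[a *: u, v] = a * '[u, v].
Proof. by rewrite linearZl_LR. Qed.

Lemma innerZr a u v : '[u, a *: v] = a^* * '[u, v].
Proof. by rewrite linearZr_LR. Qed.

Lemma inner_sum I J (r : seq I) (s : seq J) (u : I -> H) (v : J -> H) :
  '[\sum_(i <- r) u i, \sum_(j <- s) v j] =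
  \sum_(i <- r) \sum_(j <- s) '[u i, v j].
Proof.
rewrite [LHS]linear_sumlz; apply: eq_bigr => i _.
by rewrite [LHS]linear_sumr.
Qed.

Lemma inner_polar (u v : H) :
  '[u, v] = 4^-1 * (`|u + v| ^+ 2 - `|u - v| ^+ 2
    + 'i * (`|u + 'i *: v| ^+ 2 - `|u - 'i *: v| ^+ 2)).
Proof.
rewrite -!innerE -(scaleN1r v) -scaleNr !(innerDl, innerDr) !(innerZl, innerZr).
rewrite !rmorphN/= conjCi conjC1.
set a := '[u, u]; set b := '[u, v]; set c := '[v, u]; set d := '[v, v].
have i2 : 'i * 'i = -1 :> R[i] by rewrite -expr2 sqrCi.
rewrite [RHS](_ : _ = 4^-1 * (2 * b + 2 * c + 2 * ('i * 'i) * (c - b))).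
  by rewrite i2; field.
by ring.
Qed.

(** The record [hilbert] ties the form to the norm only through [innerE]; polarization then reduces
    continuity of the form to that of the norm. *)
Lemma continuous_inner (T : topologicalType) (f g : T -> H) :
  continuous f -> continuous g -> continuous (fun x => '[f x, g x] : R[i]^o).
Proof.
move=> cf cg.
have cn (c : R[i]) :
    continuous (fun x => `|f x + c *: g x| * `|f x + c *: g x| : R[i]^o).
  have cn1 : continuous (fun x => `|f x + c *: g x| : R[i]^o).
    move=> x; apply: (@cvg_norm R[i] H).
    by apply: cvgD; [exact: cf|apply: cvgZr; exact: cg].
  by move=> x; apply: (@cvgM R[i]); exact: cn1.
rewrite [X in continuous X](_ : _ = fun x =>
  4^-1 * (`|f x + 1 *: g x| * `|f x + 1 *: g x|
      - `|f x + (-1) *: g x| * `|f x + (-1) *: g x|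
    + 'i * (`|f x + 'i *: g x| * `|f x + 'i *: g x|
      - `|f x + (- 'i) *: g x| * `|f x + (- 'i) *: g x|)) : R[i]^o).
  move=> x; apply: (@cvgMr R[i]); apply: (@cvgD _ R[i]^o).
    by apply: (@cvgB _ R[i]^o); exact: cn.
  by apply: (@cvgMr R[i]); apply: (@cvgB _ R[i]^o); exact: cn.
by apply/funext => x; rewrite inner_polar !expr2 scale1r scaleN1r scaleNr.
Qed.

Lemma inner_nondeg (u : H) : '[u, u] = 0 -> u = 0.
Proof. by rewrite innerE => /eqP; rewrite sqrf_eq0 normr_eq0 => /eqP. Qed.

Variable T : {linear H -> H}.
Hypothesis T_ge0 : forall u, 0 <= '[T u, u].

(** The form is real at [u + v] and at [u + 'i *: v]. With b = <Tu,v> and c = <Tv,u> in the order of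
    [inner], the first makes b + c real and the second makes c - b purely imaginary; together c is
    the conjugate of b. *)
Lemma psd_herm u v : '[T v, u] = '[T u, v]^*.
Proof.
have re w : '[T w, w]^* = '[T w, w] by rewrite geC0_conj.
have := re (u + v); have := re (u + 'i *: v).
rewrite !linearD !linearZ/= !(innerDl, innerDr, innerZl, innerZr).
rewrite !(rmorphD, rmorphM)/= !re !conjCK !conjCi.
set a := '[T u, u]; set b := '[T u, v]; set c := '[T v, u]; set d := '[T v, v].
have i2 : 'i * 'i = -1 :> R[i] by rewrite -expr2 sqrCi.
have i0 : 'i != 0 :> R[i] by rewrite neq0Ci.
move=> /eqP; rewrite -subr_eq0 => /eqP ei /eqP; rewrite -subr_eq0 => /eqP e1.
have {}e1 : b^* + c^* - b - c = 0 by rewrite -[RHS]e1; ring.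
have {}ei : 'i * (b^* - c^* + b - c) = 0.
  by rewrite -[RHS]ei; ring: i2.
move/eqP: ei; rewrite mulf_eq0 (negPf i0) /= => /eqP ei.
apply/eqP; rewrite -subr_eq0 -(mulrI_eq0 _ (mulfI (_ : 2 != 0 :> R[i])))//.
apply/eqP; transitivity (- ((b^* + c^* - b - c) + (b^* - c^* + b - c))).
  by ring.
by rewrite e1 ei addr0 oppr0.
Qed.

Lemma psd_null u : '[T u, u] = 0 -> T u = 0.
Proof.
move=> u0; apply: inner_nondeg.
have tu v : '[T v, u] = '[T u, v]^* by exact: psd_herm.
suff h : (2 * '[T u, T u]) = 0.
  by apply/eqP; move/eqP: h; rewrite mulf_eq0 pnatr_eq0.
(* Perturbing [u] to [u + s *: T u] with [s] real gives a nonnegative quadratic in [s] without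
   constant term, whose linear coefficient is twice the squared norm of [T u]. *)
apply: (@ge0_quad_lin0 _ _ '[T (T u), T u]) => s sr.
have := T_ge0 (u + s *: T u).
rewrite linearD linearZ/= !(innerDl, innerDr, innerZl, innerZr) u0 tu.
rewrite (conj_Creal sr) geC0_conj ?dnorm_ge0//.
by congr (0 <= _); ring.
Qed.

End InnerProduct.

(** * Tensor operators and the vanishing of the PR weight *)

Section TensorOperators.
Variables (R : realType) (HA HB : hilbert R) (H : hilbert_tensor HA HB).

Lemma tensor_ext (f g : {linear H -> H}) :
    continuous f -> continuous g ->
    (forall u v, f (tensor H u v) = g (tensor H u v)) -> f =1 g.
Proof.
move=> cf cg fg.
apply: (eq_continuous_dense (@tensor_dense _ _ _ H) cf cg) => w.
rewrite inE => -[n [u [v ->]]]; rewrite !linear_sum.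
by apply: eq_bigr => i _; exact: fg.
Qed.

Lemma tensor_op_ge0 (E : {linear HA -> HA}) (F : {linear HB -> HB})
    (T : {linear H -> H}) :
  is_tensor_op E F T ->
  (forall u, 0 <= inner HA (E u) u) -> (forall v, 0 <= inner HB (F v) v) ->
  forall w, 0 <= inner H (T w) w.
Proof.
(* Nonnegativity of z is rewritten as |z| = z, an equation between continuous functions that can be
   checked on a dense set. *)
move=> [cT TE] E0 F0 w; rewrite ger0_def; apply/eqP; move: w.
have cq : continuous (fun w : H => inner H (T w) w : R[i]^o).
  by apply: continuous_inner => // w; exact: cvg_id.
have cn : continuous (fun w : H => `|inner H (T w) w| : R[i]^o).
  by move=> w; apply: (@cvg_norm R[i] R[i]^o); exact: cq.
apply: (eq_continuous_dense (@tensor_dense _ _ _ H) cn cq) => w.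
rewrite inE => -[n [u [v ->]]] /=; apply/ger0_norm.
rewrite (linear_sum T) inner_sum.
under eq_bigr do under eq_bigr do rewrite TE inner_tensor.
(* On a finite sum of simple tensors the form is the sum of the entrywise product of two Gram-type
   matrices; [sesq] shows that each is positive semidefinite. *)
have sesq (K : hilbert R) (S : {linear K -> K}) (z : 'I_n -> K) c :
    \sum_i \sum_j c i * (c j)^* * inner K (S (z i)) (z j) =
    inner K (S (\sum_i c i *: z i)) (\sum_i c i *: z i).
  rewrite (linear_sum S) inner_sum; apply: eq_bigr => i _.
  by apply: eq_bigr => j _; rewrite (linearZ_LR S) innerZl innerZr mulrA.
apply: schur_product_ge0 => [i j|c|c].
- exact: psd_herm.
- by rewrite sesq.
- by rewrite sesq.
Qed.

Variables (E : bool -> bool -> {linear HA -> HA})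
  (F : bool -> bool -> {linear HB -> HB})
  (T : bool -> bool -> bool -> bool -> {linear H -> H}).
Hypothesis E_povm : forall x, is_povm (E x).
Hypothesis F_povm : forall y, is_povm (F y).
Hypothesis T_op : forall a b x y, is_tensor_op (E x a) (F y b) (T a b x y).

Let cT a b x y : continuous (T a b x y).
Proof. by have [] := T_op a b x y. Qed.

Let TE a b x y u v : T a b x y (tensor H u v) = tensor H (E x a u) (F y b v).
Proof. by have [_] := T_op a b x y. Qed.

Let cD (S S' : {linear H -> H}) :
  continuous S -> continuous S' -> continuous (S \+ S').
Proof. by move=> cS cS' w; apply: cvgD; [exact: cS|exact: cS']. Qed.

Let EE x u : E x true u + E x false u = u.
Proof. by have [_ _ /(_ u)] := E_povm x; rewrite big_bool. Qed.

Let FE y v : F y true v + F y false v = v.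
Proof. by have [_ _ /(_ v)] := F_povm y; rewrite big_bool. Qed.

(* E_a^x (x) 1 is recovered as the sum over b of E_a^x (x) F_b^y, for any y. *)
Lemma marginal_tensorl a x y u v :
  T a true x y (tensor H u v) + T a false x y (tensor H u v) =
  tensor H (E x a u) v.
Proof. by rewrite !TE -linearDr FE. Qed.

Lemma marginal_tensorr b x y u v :
  T true b x y (tensor H u v) + T false b x y (tensor H u v) =
  tensor H u (F y b v).
Proof. by rewrite !TE -linearDl EE. Qed.

(** No-signalling at the level of operators: both sides are E_a^x (x) 1, by agreement on simple
    tensors. *)
Lemma marginal_indep a x y y' w :
  T a true x y w + T a false x y w = T a true x y' w + T a false x y' w.
Proof.
apply: (@tensor_ext (T a true x y \+ T a false x y)
  (T a true x y' \+ T a false x y')); [exact: cD|exact: cD|].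
by move=> u v; rewrite /= !marginal_tensorl.
Qed.

(** This is E (x) F = (E (x) 1)(1 (x) F), each factor being written as a marginal. The auxiliary
    inputs [x'] and [y'] are free, so they can be chosen where [Psi] is annihilated. *)
Lemma marginal_comp a b x y x' y' w :
  T a b x y w = (T a true x y' \+ T a false x y')
                  (T true b x' y w + T false b x' y w).
Proof.
apply: (@tensor_ext _ ((T a true x y' \+ T a false x y') \o
  (T true b x' y \+ T false b x' y))) => //.
  by move=> z; apply: continuous_comp; exact: cD.
by move=> u v; rewrite /= marginal_tensorr marginal_tensorl TE.
Qed.

Lemma tensor_povm_PR_vanish (Psi : H) :
    let p a b x y := inner H (T a b x y Psi) Psi in
    (forall a b x y, x && y = false -> a (+) b -> p a b x y = 0) ->
  p true false true true = 0.
Proof.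
move=> p p0.
have T0 a b x y : x && y = false -> a (+) b -> T a b x y Psi = 0.
  move=> xy ab; apply: psd_null; last exact: p0.
  by apply: (tensor_op_ge0 (T_op _ _ _ _)); [case: (E_povm x)|case: (F_povm y)].
(* Both vectors equal (E_0^0 (x) 1) Psi, since the terms with b = 1 vanish. *)
have e : T false false false true Psi = T false false false false Psi.
  have := marginal_indep false false true false Psi.
  by rewrite (T0 false true false true)// (T0 false true false false)// !add0r.
rewrite /p (marginal_comp _ _ _ _ false false).
have -> : T true false false true Psi + T false false false true Psi =
          T true false false false Psi + T false false false false Psi.
  by rewrite e (T0 true false false true)// (T0 true false false false).
(* Refolding with Bob's input changed from 1 to 0 gives E_1^1 (x) F_0^0: the outcomes differ while
   xy = 0, so [T0] applies. *)
rewrite -(marginal_comp true false true false false false) T0//.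
exact: linear0l.
Qed.

End TensorOperators.

(** * The Hermitian form and norm on complex functions over a finite type *)

Section EuclideanForm.
Variables (R : realType) (I : finType).

Definition l2 : Type := {ffun I -> R[i]^o}.

HB.instance Definition _ := Vector.on l2.

Definition l2_inner (u v : l2) : R[i] := \sum_i u i * (v i)^*.

Lemma l2_inner_bilinear :
  bilinear_for *%R (@Num.conj R[i] \; *%R) l2_inner.
Proof.
split=> [v c u u'|u c v v'] /=; rewrite /l2_inner mulr_sumr -big_split;
  apply: eq_bigr => i _ /=; rewrite !ffunE.
- by rewrite mulrDl -mulrA.
- by rewrite rmorphD rmorphM/= mulrDr mulrCA.
Qed.

HB.instance Definition _ :=
  bilinear_isBilinear.Build R[i] l2 l2 R[i] _ _ l2_inner l2_inner_bilinear.

Lemma l2_inner_herm (u v : l2) :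
  l2_inner u v = (-1) ^+ false * (l2_inner v u)^*.
Proof.
rewrite mul1r rmorph_sum; apply: eq_bigr => i _.
by rewrite rmorphM/= conjCK mulrC.
Qed.

HB.instance Definition _ :=
  isHermitianSesquilinear.Build R[i] l2 false (@Num.conj R[i]) l2_inner
    l2_inner_herm.

Lemma l2_inner_gt0 (u : l2) : u != 0 -> 0 < l2_inner u u.
Proof.
move=> u0; have u2 i : 0 <= u i * (u i)^* by rewrite mul_conjC_ge0.
rewrite lt_def sumr_ge0 // andbT; apply: contra u0.
rewrite psumr_eq0// => /allP u0; apply/eqP/ffunP => i; apply/eqP.
by have := u0 i; rewrite mem_index_enum mul_conjC_eq0 ffunE => /implyP; exact.
Qed.

HB.instance Definition _ :=
  isDotProduct.Build R[i] l2 l2_inner l2_inner_gt0.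

Definition l2_norm (u : l2) : R[i] := sqrtC (l2_inner u u).

Lemma l2_normD (u v : l2) : l2_norm (u + v) <= l2_norm u + l2_norm v.
Proof. exact: (triangle_lerif l2_inner). Qed.

Lemma l2_normZ (a : R[i]) (u : l2) : l2_norm (a *: u) = `|a| * l2_norm u.
Proof.
rewrite /l2_norm (dnormZ l2_inner) sqrtCM ?nnegrE ?exprn_ge0//.
by rewrite sqrCK.
Qed.

Lemma l2_norm0_eq0 (u : l2) : l2_norm u = 0 -> u = 0.
Proof. by move/eqP; rewrite (sqrt_dnorm_eq0 l2_inner) => /eqP. Qed.

HB.instance Definition _ :=
  Lmodule_isNormed.Build R[i] l2 l2_normD l2_normZ l2_norm0_eq0.

End EuclideanForm.

(** * Completeness of the Euclidean norm *)

Section EuclideanSpace.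
Variables (R : realType) (I : finType).
Local Notation V := (l2 R I).

Lemma l2_innerE (u : V) : l2_inner u u = `|u| ^+ 2.
Proof. by rewrite sqrtCK. Qed.

Lemma normr_l2_coord (u : V) i : `|u i : R[i]| <= `|u|.
Proof.
rewrite -(@ler_sqr _) ?nnegrE// -l2_innerE normCK /l2_inner (bigD1 i)//=.
by rewrite lerDl sumr_ge0// => j _; rewrite mul_conjC_ge0.
Qed.

Lemma l2_norm_sum (u : V) : `|u| <= \sum_i `|u i : R[i]|.
Proof.
rewrite -(@ler_sqr _) ?nnegrE ?sumr_ge0// -l2_innerE /l2_inner.
rewrite expr2 mulr_suml; apply: ler_sum => i _.
rewrite -normCK expr2 ler_wpM2l// (bigD1 i)//= lerDl.
exact: sumr_ge0.
Qed.

Let normr_i : `|('i)%C : R[i]| = 1.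
Proof. by rewrite normc_def/= expr0n expr1n add0r sqrtr1. Qed.

Lemma normc_le_ReIm (z : R[i]) :
  `|z| <= (`|complex.Re z| + `|complex.Im z|)%:C%C.
Proof.
rewrite {1}(complexE z) rmorphD /= (le_trans (ler_normD _ _))//.
by rewrite normrM normr_i mul1r !normc_def/= expr0n/= !addr0 !sqrtr_sqr.
Qed.

Lemma normc_ge_Im (z : R[i]) : `|complex.Im z|%:C%C <= `|z|.
Proof.
rewrite -(normrN (complex.Im z)) -ReiNIm (le_trans (normc_ge_Re _))//.
by rewrite normrM normr_i mulr1.
Qed.

(** A nonexpansive map sends Cauchy filters to Cauchy filters, and [R] is complete. It is applied to
    the real and imaginary parts of coordinates. *)
Lemma cauchy_cvg_nonexpansive (f : V -> R) (F : set_system V) :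
  (forall u v, `|f u - f v|%:C%C <= `|u - v|) -> ProperFilter F -> cauchy F ->
  exists l : R, f @ F --> l.
Proof.
move=> fle FF /cauchy_ballP Fc; apply/cvg_ex; apply: R_complete.
apply/cauchy_ballP => e e0.
have e0' : 0 < e%:C%C :> R[i] by rewrite ltcR.
have [[A B] [FA FB] AB] := Fc _ e0'.
exists (f @` A, f @` B) => /=.
  by split; [apply: filterS FA|apply: filterS FB] => u Au; exists u.
move=> [_ _] [/= [u Au <-] [v Bv <-]]; have /= := AB (u, v) (conj Au Bv).
rewrite -!ball_normE /= => uv.
by rewrite -ltcR; exact: le_lt_trans uv.
Qed.

Lemma l2_complete (F : set_system V) : ProperFilter F -> cauchy F -> cvg F.
Proof.
move=> FF Fc.
pose re i (u : V) := complex.Re (u i : R[i]).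
pose im i (u : V) := complex.Im (u i : R[i]).
have reB i u v : re i (u - v) = re i u - re i v.
  by rewrite /re !ffunE; case: (u i) (v i) => [? ?] [? ?].
have imB i u v : im i (u - v) = im i u - im i v.
  by rewrite /im !ffunE; case: (u i) (v i) => [? ?] [? ?].
have /choice [a aP] : forall i, exists l : R, re i @ F --> l.
  move=> i; apply: cauchy_cvg_nonexpansive => // u v; rewrite -reB.
  exact: le_trans (normc_ge_Re _) (normr_l2_coord _ _).
have /choice [b bP] : forall i, exists l : R, im i @ F --> l.
  move=> i; apply: cauchy_cvg_nonexpansive => // u v; rewrite -imB.
  exact: le_trans (normc_ge_Im _) (normr_l2_coord _ _).
pose l : V := [ffun i => (a i +i* b i)%C].
apply/cvg_ex; exists l; apply/(@cvgrPdist_lt _ V _ F _ id l) => e.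
(* Positivity in [R[i]] forces [e] to be real, so the estimate can be made in [R]. *)
rewrite ltcE => /andP[/= /eqP eI eR].
(* A real majorant of the distance from [u] to [l]; it tends to 0 because each coordinate part
   converges. *)
pose S u := \sum_i (`|a i - re i u| + `|b i - im i u|).
have S0 : S u @[u --> F] --> (0 : R).
  rewrite -[X in _ --> X](_ : \sum_(i : I) (0 : R) = 0); last exact: big1.
  apply: cvg_big => [|i _]; first exact: add_continuous.
  rewrite -[X in _ --> X](_ : `|a i - a i| + `|b i - b i| = 0); last first.
    by rewrite !subrr !normr0 addr0.
  by apply: cvgD; apply: cvg_norm; apply: cvgB;
    [exact: cvg_cst|exact: aP|exact: cvg_cst|exact: bP].
have : \forall u \near F, S u < complex.Re e.
  have /cvgrPdist_lt /(_ _ eR) := S0; apply: filterS => u.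
  by rewrite sub0r normrN; exact: le_lt_trans (ler_norm _).
apply: filterS => u Su.
apply: (le_lt_trans (l2_norm_sum _)).
rewrite (_ : e = (complex.Re e)%:C%C); last first.
  by case: e eI {eR Su} => ? ? /= ->.
rewrite -ltcR in Su; apply: le_lt_trans Su.
rewrite /S rmorph_sum; apply: ler_sum => i _.
rewrite (le_trans (normc_le_ReIm _))// lecR.
have := reB i l u; have := imB i l u; rewrite /re /im => -> ->.
by rewrite !ffunE.
Qed.

HB.instance Definition _ := Uniform_isComplete.Build V l2_complete.

Definition l2_hilbert : hilbert R := @Hilbert R V (@l2_inner R I) l2_innerE.

End EuclideanSpace.

Lemma contraction_continuous (K : numFieldType) (V W : normedModType K)
  (f : {linear V -> W}) : (forall u, `|f u| <= `|u|) -> continuous f.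
Proof.
move=> fle u; apply/cvgrPdist_lt => e e0; near=> v.
by rewrite -linearB (le_lt_trans (fle _)).
Unshelve. all: by end_near. Qed.

(** * Coordinate projections *)

Section Mask.
Variables (R : realType) (I : finType).
Local Notation V := (l2 R I).

(** The orthogonal projection onto the span of the basis vectors indexed by [P]. *)
Definition l2_mask (P : pred I) (u : V) : V :=
  [ffun i => if P i then u i else 0].

Lemma l2_mask_linear P : linear (l2_mask P).
Proof.
move=> c u v; apply/ffunP => i; rewrite !ffunE.
by case: ifP => // _; rewrite scaler0 addr0.
Qed.

HB.instance Definition _ P :=
  GRing.isLinear.Build R[i] V V *:%R (l2_mask P) (l2_mask_linear P).

Lemma l2_mask_innerE P (u : V) :
  l2_inner (l2_mask P u) u = \sum_(i | P i) `|u i : R[i]| ^+ 2.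
Proof.
rewrite [RHS]big_mkcond; apply: eq_bigr => i _; rewrite ffunE normCK.
by case: ifP; rewrite ?mul0r.
Qed.

Lemma l2_mask_norm P (u : V) : `|l2_mask P u| <= `|u|.
Proof.
rewrite -(@ler_sqr _) ?nnegrE// -!l2_innerE; apply: ler_sum => i _.
by rewrite ffunE; case: ifP => // _; rewrite mul0r mul_conjC_ge0.
Qed.

Lemma l2_mask_continuous P : continuous (l2_mask P).
Proof. exact/contraction_continuous/l2_mask_norm. Qed.

End Mask.

(** * The tensor product of two Euclidean spaces *)

Section Tensor.
Variables (R : realType) (I J : finType).

Definition l2_tensor (u : l2 R I) (v : l2 R J) : l2 R (I * J)%type :=
  [ffun p => u p.1 * v p.2].

Lemma l2_tensor_bilinear : bilinear_for *:%R *:%R l2_tensor.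
Proof.
split=> [v c u u'|u c v v']; apply/ffunP => p; rewrite !ffunE.
- by rewrite mulrDl /GRing.scale/= mulrA.
- by rewrite mulrDr /GRing.scale/= mulrCA.
Qed.

HB.instance Definition _ :=
  bilinear_isBilinear.Build R[i] (l2 R I) (l2 R J) (l2 R (I * J)%type) _ _
    l2_tensor l2_tensor_bilinear.

Lemma l2_inner_tensor (u u' : l2 R I) (v v' : l2 R J) :
  l2_inner (l2_tensor u v) (l2_tensor u' v') = l2_inner u u' * l2_inner v v'.
Proof.
rewrite /l2_inner big_distrlr pair_bigA; apply: eq_bigr => p _ /=.
by rewrite !ffunE rmorphM/= mulrACA.
Qed.

(** In finite dimension the simple tensors span everything: w is the sum over i of e_i (x) w(i,
    .). *)
Lemma l2_tensor_dense : dense [set w : l2 R (I * J)%type |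
  exists (n : nat) (u : 'I_n -> l2 R I) (v : 'I_n -> l2 R J),
    w = \sum_i l2_tensor (u i) (v i)].
Proof.
move=> O [w Ow] _; exists w; split => //; exists #|I|.
exists (fun k => [ffun i => (i == enum_val k)%:R]).
exists (fun k => [ffun j => w (enum_val k, j)]).
apply/ffunP => -[i j]; rewrite sum_ffunE (bigD1 (enum_rank i))//= !ffunE/=.
rewrite enum_rankK eqxx mul1r big1 ?addr0// => k ki; rewrite !ffunE/=.
have [ik|] := eqVneq i (enum_val k); last by rewrite mul0r.
by rewrite ik enum_valK eqxx in ki.
Qed.

Definition l2_hilbert_tensor :
    hilbert_tensor (l2_hilbert R I) (l2_hilbert R J) :=
  @HilbertTensor R (l2_hilbert R I) (l2_hilbert R J)
    (l2_hilbert R (I * J)%type) l2_tensor l2_inner_tensor l2_tensor_dense.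

End Tensor.

(** * Quantum realisation of perfectly correlated boxes *)

Lemma l2_mask_povm (R : realType) (I : finType) (P : bool -> pred I) :
  (forall i, P true i = ~~ P false i) ->
  @is_povm R (l2_hilbert R I) (fun a => l2_mask (P a)).
Proof.
move=> PC; split => [a|a u|u].
- exact: l2_mask_continuous.
- by rewrite [X in 0 <= X]l2_mask_innerE sumr_ge0// => i _; rewrite exprn_ge0.
- rewrite big_bool; apply/ffunP => i; rewrite !ffunE PC.
  by case: (P false i); rewrite ?addr0 ?add0r.
Qed.

Lemma quantum_correlated (R : realType) (w : bool -> R) :
  (forall a, 0 <= w a) -> \sum_a w a = 1 ->
  quantum_set R (fun a b _ _ => (a == b)%:R * w a).
Proof.
move=> w0 w1.
(* Square roots of the weights on the diagonal, so that the squared amplitudes are the entries of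
   the box. *)
pose Psi : l2 R (bool * bool)%type :=
  [ffun p => (p.1 == p.2)%:R * (Num.sqrt (w p.1))%:C%C].
have Psi2 p : `|Psi p : R[i]| ^+ 2 = ((p.1 == p.2)%:R * w p.1)%:C%C.
  rewrite ffunE; case: eqP => _; last by rewrite !mul0r normr0 expr0n.
  rewrite !mul1r normc_def /= expr0n /= addr0 sqrtr_sqr ger0_norm ?sqrtr_ge0//.
  by rewrite -rmorphXn/= sqr_sqrtr.
exists (l2_hilbert R bool), (l2_hilbert R bool).
exists (l2_hilbert_tensor R bool bool).
exists (fun _ a => l2_mask (pred1 a)), (fun _ b => l2_mask (pred1 b)).
exists (fun a b _ _ => l2_mask (pred1 (a, b))), Psi; split.
- by move=> x; apply: l2_mask_povm => -[].
- by move=> x; apply: l2_mask_povm => -[].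
- move=> a b x y; split; first exact: l2_mask_continuous.
  move=> u v; apply/ffunP => -[i j]; rewrite !ffunE/= xpair_eqE.
  by case: eqP => _; case: eqP => _; rewrite ?mulr0 ?mul0r.
- apply/eqP; rewrite -sqrp_eq1// -l2_innerE /l2_inner.
  under eq_bigr do rewrite -normCK Psi2.
  rewrite -rmorph_sum -(pair_bigA _ (fun a b => (a == b)%:R * w a))/=.
  rewrite (eq_bigr w) ?w1// => a _; rewrite (bigD1 a)//= eqxx mul1r.
  by rewrite big1 ?addr0// => b /negPf; rewrite eq_sym => ->; rewrite mul0r.
- by move=> a b x y; rewrite [RHS]l2_mask_innerE big_pred1_eq Psi2.
Qed.

(** * Convex combinations of boxes and the void *)

Lemma box_sumE (R : realType) n (w : 'I_n -> R) (q : 'I_n -> box R) a b x y :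
  (\sum_i w i *: q i) a b x y = \sum_i w i * q i a b x y.
Proof. by rewrite !fct_sumE. Qed.

Lemma Conv_P0_P1E (R : realType) (P : box R) :
  Conv [set P0 R; P1 R] P ->
  exists w : bool -> R, [/\ forall a, 0 <= w a, \sum_a w a = 1 &
    P = fun a b _ _ => (a == b)%:R * w a].
Proof.
move=> [n [w [q [w0 w1 qP ->]]]].
(* The entry at (1,1|0,0) is 0 for [P0] and 1 for [P1], so it tells which of the two [q i] is; equal
   vertices are then grouped by weight. *)
pose is1 i := q i true true false false == 1.
exists (fun a => \sum_(i | is1 i == a) w i); split.
- by move=> a; apply: sumr_ge0.
- rewrite -w1 big_bool [RHS](bigID is1)/=.
  by congr (_ + _); apply: eq_bigl => i; case: (is1 i).
- apply/funext => a; apply/funext => b; apply/funext => x; apply/funext => y.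
  rewrite box_sumE mulr_sumr [RHS]big_mkcond; apply: eq_bigr => i _.
  have [qi|qi] := qP i; rewrite /is1 qi /P0 /P1 /=.
    rewrite (_ : (_ == 1) = false) /=; last by rewrite eq_sym oner_eq0.
    by case: a b => [] []; rewrite /= ?mulr0 ?mul0r ?mulr1 ?mul1r.
  rewrite eqxx.
  by case: a b => [] []; rewrite /= ?mulr0 ?mul0r ?mulr1 ?mul1r.
Qed.

Lemma Conv_subset (R : realType) (V : lmodType R) (A B : set V) :
  A `<=` B -> Conv A `<=` Conv B.
Proof.
move=> AB _ [n [w [q [w0 w1 qA ->]]]]; exists n, w, q; split => // i.
exact/AB/qA.
Qed.

Theorem corollary27 (R : realType) :
  quantum_set R `&` Conv [set PR R; P0 R; P1 R] = Conv [set P0 R; P1 R].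
Proof.
apply/seteqP; split => [P []|P CP]; last first.
  split; last by apply: Conv_subset CP => B [->|->]; [left; right|right].
  by have [w [w0 w1 ->]] := Conv_P0_P1E CP; exact: quantum_correlated.
move=> [HA [HB [H [E [F [T [Psi [Ep Fp Top _ PE]]]]]]]].
move=> [n [w [q [w0 w1 qP P_def]]]].
have P10 : P true false true true = 0.
  apply: complexI; rewrite PE; apply: (tensor_povm_PR_vanish Ep Fp Top).
  move=> a b x y xy ab; rewrite -PE P_def box_sumE.
  rewrite big1 => [|i _]; first exact: rmorph0.
  (* All three vertices vanish at differing outcomes when xy = 0. *)
  have [[->|->]|->] := qP i; rewrite ?/PR ?/P0 ?/P1 ?xy ?ab/= ?mulr0//;
    by move: ab; case: a b => [] []; rewrite ?mulr0.
(* A vanishing sum of nonnegative terms has only zero terms. As [PR] has entry 1/2 here, every index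
   carrying [PR] has weight 0. *)
have {}P10 i : w i * q i true false true true = 0.
  apply/eqP; move/eqP: P10; rewrite P_def box_sumE psumr_eq0.
    by move/allP => /(_ i); rewrite mem_index_enum => /(_ isT).
  move=> j _; rewrite mulr_ge0//.
  by have [[->|->]|->] := qP j; rewrite ?mulr_ge0 ?invr_ge0.
(* Vertices equal to [PR] are replaced by [P0], an arbitrary choice in the smaller set that leaves
   the sum unchanged because their weight is 0. *)
exists n, w, (fun i => if pselect (q i = PR R) then P0 R else q i); split=> //.
- move=> i; case: pselect => [e|qi] /=; first by left.
  by have [[]|] := qP i; [|left|right].
- rewrite P_def; apply: eq_bigr => i _; case: pselect => //= qi.
  suff -> : w i = 0 by rewrite !scale0r.
  have := P10 i; rewrite qi /PR /= mulr1 => /eqP.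
  by rewrite mulf_eq0 invr_eq0 pnatr_eq0 orbF => /eqP.
Qed.
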